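(* There is no tournament $T$ having two distinct minimal $\tau$-retentive sets $R_1$ and $R_2$ with $|R_1|=6$ and $|R_2|\in\{6,7,8\}$.
   Context: A tournament $T$ consists of a finite vertex set $V(T)$ and an asymmetric, complete binary relation $\succ$ on $V(T)$ ($x$ dominates $y$ if $x\succ y$). For $v\in V(T)$ let $N^-_T(v)=\{u\in V(T): u\succ v\}$; for $B\subseteq V(T)$, $T[B]$ is the induced subtournament. The tournament equilibrium set $\tau$ is defined recursively: a nonempty $A\subseteq V(T)$ is $\tau$-retentive if for every $v\in A$ with $N^-_T(v)\neq\emptyset$, $\tau(T[N^-_T(v)])\subseteq A$; $A$ is a minimal $\tau$-retentive set if no $\tau$-retentive set of $T$ is a proper subset of $A$; $\tau(T)$ is the union of all minimal $\tau$-retentive sets of $T$. *)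

(* Defs.v *)
From mathcomp Require Import all_boot.

Set Implicit Arguments.
Unset Strict Implicit.
Unset Printing Implicit Defensive.

Record tournament := Tournament {
  vertex :> finType;
  dominates : rel vertex;
  dominates_asym : forall x y, dominates x y -> ~~ dominates y x;
  dominates_complete : forall x y, x != y -> dominates x y || dominates y x
}.

(* An induced subtournament T[B] is represented by its vertex set B, the       *)
(* dominance relation being that of T; the tournament T itself is [set: T].    *)
(* All notions below that take B as their first set argument are those of T[B]. *)

(* N^-_{T[B]}(v) *)
Definition dominators (T : tournament) (B : {set T}) (v : T) : {set T} :=
  [set u in B | dominates u v].

Definition retentive_for (T : tournament) (t : {set T} -> {set T})
    (B A : {set T}) : bool :=
  [&& A != set0, A \subset B &
    [forall v in A,
       (dominators B v != set0) ==> (t (dominators B v) \subset A)]].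

(* The recursion descends from B to the sets N^-_{T[B]}(v) with v \in B, which *)
(* are strictly smaller than B, so #|B| steps suffice; tauE below is the       *)
(* resulting defining equation, free of the step counter.                      *)
Fixpoint tau_rec (T : tournament) (n : nat) (B : {set T}) : {set T} :=
  if n is m.+1 then
    \bigcup_(A : {set T} | minset (retentive_for (@tau_rec T m) B) A) A
  else set0.

Definition tau (T : tournament) (B : {set T}) : {set T} := tau_rec #|B| B.

Definition retentive (T : tournament) (B A : {set T}) : bool :=
  retentive_for (@tau T) B A.

Definition min_retentive (T : tournament) (B A : {set T}) : bool :=
  minset (retentive B) A.

Lemma dominates_irr (T : tournament) (x : T) : dominates x x = false.
Proof. by apply/negP => xx; move: (dominates_asym xx); rewrite xx. Qed.

Lemma card_dominators (T : tournament) (B : {set T}) (v : T) :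
  v \in B -> #|dominators B v| < #|B|.
Proof.
move=> vB; apply: proper_card; apply/properP; split.
  by apply/subsetP => u; rewrite inE => /andP[].
by exists v; rewrite // inE dominates_irr andbF.
Qed.

Lemma eq_retentive_for (T : tournament) (t1 t2 : {set T} -> {set T})
    (B : {set T}) :
    (forall v, v \in B -> t1 (dominators B v) = t2 (dominators B v)) ->
  retentive_for t1 B =1 retentive_for t2 B.
Proof.
move=> t12 A; rewrite /retentive_for; congr (_ && _).
case: (boolP (A \subset B)) => //= sAB.
by apply: eq_forallb_in => v vA; rewrite t12 // (subsetP sAB).
Qed.

Lemma tau_rec_stable (T : tournament) (n : nat) (B : {set T}) :
  #|B| <= n -> tau_rec n B = tau B.
Proof.
rewrite /tau; have [k] := ubnP #|B|.
elim: k B n => // k IHk B [|n] /ltnSE leBk leBn.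
  by move: leBn; rewrite leqn0 => /eqP->.
case EB: #|B| leBk leBn => [|m] leBk leBn.
  have /eqP B0 : B == set0 by rewrite -cards_eq0 EB.
  rewrite /= big_pred0 // => A; apply/negP => /minsetp /and3P[A0].
  by rewrite B0 subset0 (negPf A0).
rewrite /=; apply: eq_bigl => A; apply: minset_eq => {}A.
apply: eq_retentive_for => v vB.
have := card_dominators vB; rewrite EB ltnS => ltv.
have ltk : #|dominators B v| < k by apply: leq_ltn_trans ltv _.
by rewrite (IHk _ n) ?(IHk _ m) // (leq_trans ltv).
Qed.

Lemma tauE (T : tournament) (B : {set T}) :
  tau B = \bigcup_(A : {set T} | min_retentive B A) A.
Proof.
rewrite -(@tau_rec_stable _ #|B|.+1) //=.
apply: eq_bigl => A; apply: minset_eq => {}A.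
apply: eq_retentive_for => v vB; apply: tau_rec_stable.
exact: ltnW (card_dominators vB).
Qed.

(* Main.v *)
Require Import Defs.
From mathcomp Require Import all_boot.
From mathcomp Require Import zify.

(* Call a set of vertices blocked if it has no common dominator in T. The
   minimal retentive sets R1 and R2 are disjoint, so if {p, q} is a blocked pair
   in one of them, then every vertex of the other is dominated by p or by q. Some
   v in R1 has in-degree at most 2 in T[R1]; then tau(T[N^-(v)]) is a singleton
   {s}, and {v, s} is blocked. Hence v and s cover R2, and it remains to show, for
   a minimal retentive set R covered by two vertices y1 and y2, that
   - R contains a blocked pair if |R| <= 8 (so that this pair covers R1), and
   - |R| is not 6.
   The first rests on the remark that a vertex y of T[B] fails to dominate at least two
   vertices of each minimal retentive set Q of T[B] with |Q| > 1.
   Split R into the set A1 of vertices dominated by y1 and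
   the rest A2. If no pair is blocked, each vertex of R has two dominators on the
   other side, so 2(|A1| + |A2|) <= |A1||A2|, which forces |A1| = |A2| = 4 and
   equality throughout; then T[A1] would be a rotational tournament on four
   vertices, and there is none. The second claim is a finite check on two-coloured
   tournaments with six vertices: minimal retentive sets of size at most 4 are
   singletons and 3-cycles, so the retentive sets inside the sets N^-(u), u in R,
   can be read off T[R]. *)

Set Implicit Arguments.
Unset Strict Implicit.
Unset Printing Implicit Defensive.

(** * Minimal retentive sets: existence, disjointness, dominance inside them *)

Lemma in_dominators (T : tournament) (B : {set T}) (v u : T) :
  (u \in dominators B v) = (u \in B) && dominates u v.
Proof. by rewrite inE. Qed.

Lemma dominates_neq (T : tournament) (x y : T) : dominates x y -> x != y.
Proof. by apply: contraTneq => ->; rewrite dominates_irr. Qed.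

Lemma dominatesN (T : tournament) (x y : T) :
  x != y -> dominates x y = ~~ dominates y x.
Proof.
move=> /dominates_complete /orP[xy|yx].
  by rewrite xy dominates_asym.
by rewrite yx; apply/negbTE/dominates_asym.
Qed.

Lemma tau_sub (T : tournament) (B : {set T}) : tau B \subset B.
Proof.
rewrite tauE; apply/bigcupsP => A /minsetp.
by rewrite /retentive /retentive_for => /and3P[].
Qed.

Lemma min_retentive_exists (T : tournament) (B : {set T}) (x : T) : x \in B ->
  exists2 Q, min_retentive B Q & Q \subset tau B.
Proof.
move=> xB; have rB : retentive B B.
  apply/and3P; split=> //; first by apply/set0Pn; exists x.
  apply/forall_inP => v vB; apply/implyP => _.
  apply: subset_trans (tau_sub _) _.
  by apply/subsetP => u; rewrite in_dominators => /andP[].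
have [Q minQ _] := minset_exists rB.
by exists Q => //; rewrite tauE (bigcup_max Q).
Qed.

Lemma min_retentive_sub (T : tournament) (B Q : {set T}) :
  min_retentive B Q -> Q \subset B.
Proof. by move/minsetp => /and3P[]. Qed.

Lemma min_retentive_neq0 (T : tournament) (B Q : {set T}) :
  min_retentive B Q -> exists q, q \in Q.
Proof. by move/minsetp => /and3P[/set0Pn]. Qed.

Lemma min_retentive_tau (T : tournament) (B Q : {set T}) (v u : T) :
  min_retentive B Q -> v \in Q -> u \in dominators B v ->
  tau (dominators B v) \subset Q.
Proof.
move/minsetp => /and3P[_ _ /forall_inP retQ] vQ uv.
by apply: (implyP (retQ v vQ)); apply/set0Pn; exists u.
Qed.

Lemma min_retentive_step (T : tournament) (B Q : {set T}) (v u : T) :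
  min_retentive B Q -> v \in Q -> u \in dominators B v ->
  exists2 Q', min_retentive (dominators B v) Q' & Q' \subset Q.
Proof.
move=> minQ vQ uv; have [Q' minQ' sQ'] := min_retentive_exists uv.
by exists Q' => //; apply: subset_trans sQ' (min_retentive_tau minQ vQ uv).
Qed.

(** A nonempty intersection would be retentive, hence equal to both sets by minimality. *)
Lemma min_retentive_disjoint (T : tournament) (B Q1 Q2 : {set T}) :
  min_retentive B Q1 -> min_retentive B Q2 -> Q1 <> Q2 -> [disjoint Q1 & Q2].
Proof.
move=> min1 min2 neq; rewrite -setI_eq0; apply: contra_notT neq => I0.
have retI : retentive B (Q1 :&: Q2).
  apply/and3P; split=> //.
    exact: subset_trans (subsetIl _ _) (min_retentive_sub min1).
  apply/forall_inP => v /setIP[v1 v2]; apply/implyP => /set0Pn[u uv].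
  by rewrite subsetI (min_retentive_tau min1 v1 uv) (min_retentive_tau min2 v2 uv).
have [_ inf1] := minsetP min1; have [_ inf2] := minsetP min2.
by rewrite -(inf1 _ retI (subsetIl _ _)) {1}(inf2 _ retI (subsetIr _ _)).
Qed.

(* Otherwise b could be removed from Q. *)
Lemma min_retentive_pred (T : tournament) (B Q : {set T}) (b : T) :
  min_retentive B Q -> 1 < #|Q| -> b \in Q ->
  exists v Q', [/\ v \in Q, min_retentive (dominators B v) Q', b \in Q' &
                   Q' \subset Q].
Proof.
move=> minQ gt1 bQ.
case: (boolP [exists v in Q, b \in tau (dominators B v)]) => [|no].
  case/exists_inP => v vQ; rewrite tauE => /bigcupP[Q' minQ' bQ'].
  exists v, Q'; split=> //.
  have bv := subsetP (min_retentive_sub minQ') b bQ'.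
  apply: subset_trans (min_retentive_tau minQ vQ bv).
  by rewrite tauE (bigcup_max Q').
have [_ infQ] := minsetP minQ.
have retQ : retentive B (Q :\ b).
  apply/and3P; split.
  - by rewrite -card_gt0; move: gt1; rewrite (cardsD1 b) bQ.
  - exact: subset_trans (subsetDl _ _) (min_retentive_sub minQ).
  apply/forall_inP => v /setD1P[_ vQ]; apply/implyP => /set0Pn[u uv].
  rewrite subsetD1 (min_retentive_tau minQ vQ uv).
  by apply: contra no => bt; apply/exists_inP; exists v.
by have := infQ _ retQ (subsetDl _ _) => /setP/(_ b); rewrite !inE eqxx bQ.
Qed.

Lemma min_retentive1 (T : tournament) (B : {set T}) (q : T) :
  min_retentive B [set q] -> dominators B q = set0.
Proof.
move=> minq; apply/eqP; apply: contraT => /set0Pn[u uq].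
have [Q' minQ' sQ'] := min_retentive_step minq (set11 q) uq.
have [x xQ'] := min_retentive_neq0 minQ'.
have := subsetP (min_retentive_sub minQ') x xQ'.
by have /set1P-> := subsetP sQ' x xQ'; rewrite in_dominators dominates_irr andbF.
Qed.

Lemma min_retentive_dominator (T : tournament) (B Q : {set T}) (q : T) :
  min_retentive B Q -> 1 < #|Q| -> q \in Q -> exists2 u, u \in Q & dominates u q.
Proof.
move=> minQ gt1 qQ; have [_ infQ] := minsetP minQ.
have [N0|/set0Pn[u uq]] := eqVneq (dominators B q) set0.
  suff retq : retentive B [set q].
    by move: gt1; rewrite -(infQ _ retq) ?sub1set // cards1.
  apply/and3P; split; first by apply/set0Pn; exists q; rewrite set11.
    by rewrite sub1set (subsetP (min_retentive_sub minQ)).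
  by apply/forall_inP => v /set1P->; rewrite N0 eqxx.
have [Q' minQ' sQ'] := min_retentive_step minQ qQ uq.
have [x xQ'] := min_retentive_neq0 minQ'; exists x; first exact: (subsetP sQ').
by have := subsetP (min_retentive_sub minQ') x xQ'; rewrite in_dominators => /andP[].
Qed.

(** Induction on [#|B|]: if [y] dominates some [u] in [Q], then [y] lies in N^-(u), and [Q] contains
    a minimal retentive set of that smaller tournament. *)
Lemma min_retentive_undominated (T : tournament) (B Q : {set T}) (y : T) :
  min_retentive B Q -> y \in B -> exists2 q, q \in Q & ~~ dominates y q.
Proof.
have [n] := ubnP #|B|; elim: n => // n IHn in B Q * => /ltnSE leB minQ yB.
have [u uQ] := min_retentive_neq0 minQ.
case: (boolP (dominates y u)) => [yu|]; last by exists u.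
have yNu : y \in dominators B u by rewrite in_dominators yB.
have [Q' minQ' sQ'] := min_retentive_step minQ uQ yNu.
have uB := subsetP (min_retentive_sub minQ) u uQ.
have [q qQ' yq] := IHn _ _ (leq_trans (card_dominators uB) leB) minQ' yNu.
by exists q => //; apply: (subsetP sQ').
Qed.

(** Let [b] be the only vertex of [Q] not dominated by [y], and let [u] in [Q] dominate [b]. Then
    [y] lies in N^-(u), where [Q] has another vertex not dominated by [y]: it cannot be [b], since
    [b] does not dominate [u]. *)
Lemma min_retentive_undominated2 (T : tournament) (B Q : {set T}) (y : T) :
  min_retentive B Q -> 1 < #|Q| -> y \in B ->
  1 < #|[set q in Q | ~~ dominates y q]|.
Proof.
move=> minQ gt1 yB; rewrite ltnNge; apply/negP => /card_le1_eqP le1.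
have [b bQ yb] := min_retentive_undominated minQ yB.
have [u uQ ub] := min_retentive_dominator minQ gt1 bQ.
have yu : dominates y u.
  apply: contraTT ub => yu; rewrite (le1 u b) ?dominates_irr // inE.
    by rewrite uQ.
  by rewrite bQ.
have yNu : y \in dominators B u by rewrite in_dominators yB.
have [Q' minQ' sQ'] := min_retentive_step minQ uQ yNu.
have [q qQ' yq] := min_retentive_undominated minQ' yNu.
have qb : q = b by apply: le1; rewrite inE ?bQ // (subsetP sQ').
have := subsetP (min_retentive_sub minQ') q qQ'.
by rewrite qb in_dominators (negPf (dominates_asym ub)) andbF.
Qed.

(** * Rotations of a tournament on four vertices *)

Lemma uniq_subset_eq (T : finType) (A : {set T}) (s : seq T) :
  uniq s -> {subset s <= A} -> #|A| <= size s -> A =i s.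
Proof.
move=> us sA; rewrite cardE => leA.
have sA' : {subset s <= enum A} by move=> x /sA; rewrite mem_enum.
by have [_ eqs] := uniq_min_size us sA' leA; move=> x; rewrite eqs mem_enum.
Qed.

(* f would be a rotation of the four-vertex tournament T[A], under which the
   pair {x, f (f x)} is invariant. *)
Lemma no_rotation4 (T : tournament) (A : {set T}) (f : T -> T) :
    #|A| = 4 -> {in A, forall v, f v \in A} -> {in A &, injective f} ->
    {in A, forall v, dominates (f v) v} ->
  ~ {in A &, forall v w, dominates w v -> ~~ dominates w (f v)}.
Proof.
move=> A4 fA finj fdom fcov.
have fneq v : v \in A -> v != f v.
  by move=> vA; rewrite eq_sym dominates_neq ?fdom.
have ffneq v : v \in A -> v != f (f v).
  move=> vA; apply: contraTneq (fdom _ (fA _ vA)) => <-.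
  exact: dominates_asym (fdom _ vA).
(* Otherwise [f (f v)] would dominate both [v] and [f v], which [fcov] forbids. *)
have dom2 v : v \in A -> dominates v (f (f v)).
  move=> vA; rewrite dominatesN ?ffneq //; apply/negP => ffv.
  by move: (fcov _ _ vA (fA _ (fA _ vA)) ffv); rewrite (fdom _ (fA _ vA)).
have f4neq v : v \in A -> v != f (f (f (f v))).
  move=> vA; apply: contraTneq (dom2 _ (fA _ (fA _ vA))) => <-.
  exact: dominates_asym (dom2 _ vA).
(* If [f] permuted three vertices of [A], injectivity would force it to fix the fourth. *)
have f3neq v : v \in A -> v != f (f (f v)).
  move=> vA; apply/eqP => f3v.
  have us : uniq [:: v; f v; f (f v)].
    by rewrite /= !inE !negb_or fneq // ffneq // fneq ?fA.
  have [w wA ws] : exists2 w, w \in A & w \notin [:: v; f v; f (f v)].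
    apply/exists_inP; apply: contraT; rewrite negb_exists_in => /forall_inP sA.
    have : #|A| <= size [:: v; f v; f (f v)].
      rewrite cardE uniq_leq_size ?enum_uniq // => w; rewrite mem_enum => /sA.
      by rewrite negbK.
    by rewrite A4.
  have fws : f w \notin [:: v; f v; f (f v)].
    apply: contra ws; rewrite !inE {1}f3v.
    by case/or3P => /eqP /finj -> //; rewrite ?fA ?eqxx ?orbT.
  have us4 : uniq [:: w; v; f v; f (f v)] by rewrite cons_uniq ws.
  have s4 : {subset [:: w; v; f v; f (f v)] <= A}.
    by move=> x; rewrite !inE => /or4P[] /eqP-> //; rewrite ?fA.
  have := uniq_subset_eq us4 s4; rewrite A4 => /(_ isT (f w)).
  by rewrite fA // inE (negPf fws) orbF eq_sym (negPf (fneq _ wA)).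
have [v vA] : exists v, v \in A by apply/set0Pn; rewrite -card_gt0 A4.
have [v1 v2 v3] : [/\ f v \in A, f (f v) \in A & f (f (f v)) \in A].
  by rewrite !fA.
have us : uniq [:: v; f v; f (f v); f (f (f v))].
  rewrite /= !inE !negb_or !(fneq v) // !(ffneq v) // !(f3neq v) //.
  by rewrite !(fneq (f v)) // !(ffneq (f v)) // !(fneq (f (f v))).
have sA : {subset [:: v; f v; f (f v); f (f (f v))] <= A}.
  by move=> x; rewrite !inE => /or4P[] /eqP->.
have := uniq_subset_eq us sA; rewrite A4 => /(_ isT (f (f (f (f v))))).
rewrite !inE fA //.
rewrite !(eq_sym (f (f (f (f v))))) (negPf (f4neq v vA)) (negPf (f3neq _ v1)).
by rewrite (negPf (ffneq _ v2)) (negPf (fneq _ v3)).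
Qed.

(** * Minimal retentive sets with at most four vertices *)

Lemma min_retentive_sub_dominators (T : tournament) (B Q Q' : {set T}) (v : T) :
  min_retentive (dominators B v) Q' -> Q' \subset Q -> Q' \subset dominators Q v.
Proof.
move=> minQ' sQ'; apply/subsetP => x xQ'; rewrite in_dominators (subsetP sQ') //.
have := subsetP (min_retentive_sub minQ') x xQ'.
by rewrite in_dominators => /andP[].
Qed.

Lemma min_retentive_le2 (T : tournament) (B Q : {set T}) :
  min_retentive B Q -> #|Q| <= 2 -> exists q, Q = [set q].
Proof.
move=> minQ le2; apply/cards1P; rewrite eqn_leq.
rewrite [0 < _]card_gt0 andbC; apply/andP; split.
  by have [q qQ] := min_retentive_neq0 minQ; apply/set0Pn; exists q.
rewrite leqNgt; apply/negP => gt1; have /cards2P[p [q [neq eqQ]]]: #|Q| == 2.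
  by rewrite eqn_leq le2.
have [pQ qQ] : p \in Q /\ q \in Q by rewrite eqQ set21 set22.
have [u uQ up] := min_retentive_dominator minQ gt1 pQ.
have [w wQ wq] := min_retentive_dominator minQ gt1 qQ.
have qp : dominates q p.
  by move: uQ up; rewrite eqQ => /set2P[] -> //; rewrite dominates_irr.
move: wQ wq; rewrite eqQ => /set2P[] ->; last by rewrite dominates_irr.
by apply/negP; apply: dominates_asym.
Qed.

(** The dominators of [v] in [Q] contain a minimal retentive set of N^-(v); having at most two
    elements, it is a single undominated vertex. *)
Lemma min_retentive_source (T : tournament) (B Q : {set T}) (v : T) :
  min_retentive B Q -> 1 < #|Q| -> v \in Q -> #|dominators Q v| <= 2 ->
  exists2 s, s \in dominators Q v & dominators (dominators B v) s = set0.
Proof.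
move=> minQ gt1 vQ le2.
have [u uQ uv] := min_retentive_dominator minQ gt1 vQ.
have uN : u \in dominators B v.
  by rewrite in_dominators uv (subsetP (min_retentive_sub minQ)).
have [Q' minQ' sQ'] := min_retentive_step minQ vQ uN.
have sN := min_retentive_sub_dominators minQ' sQ'.
have [s eqQ'] := min_retentive_le2 minQ' (leq_trans (subset_leq_card sN) le2).
rewrite eqQ' in minQ' sN; exists s; last exact: min_retentive1.
by rewrite -sub1set.
Qed.

Lemma min_retentive_indegree (T : tournament) (B Q : {set T}) (v : T) :
  min_retentive B Q -> 1 < #|Q| -> v \in Q -> #|dominators Q v| <= #|Q|.-2.
Proof.
move=> minQ gt1 vQ.
have [u [Q' [uQ minQ' vQ' sQ']]] := min_retentive_pred minQ gt1 vQ.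
have := subsetP (min_retentive_sub_dominators minQ' sQ') v vQ'.
rewrite in_dominators => /andP[_ vu].
have : dominators Q v \subset Q :\ v :\ u.
  apply/subsetP => x; rewrite in_dominators !inE => /andP[-> xv].
  rewrite (dominates_neq xv) !andbT; apply: contraTneq xv => ->.
  exact: dominates_asym.
move/subset_leq_card; rewrite (cardsD1 v Q) vQ (cardsD1 u (Q :\ v)) !inE uQ.
by rewrite eq_sym (dominates_neq vu).
Qed.

(** With four vertices all in-degrees are at most 2, so each N^-(v) has an undominated vertex [f v]
    in [Q]. Every [b] in [Q] arises as some [f v], so [f] is a rotation as excluded by
    [no_rotation4]. *)
Lemma min_retentive_neq4 (T : tournament) (B Q : {set T}) :
  min_retentive B Q -> #|Q| != 4.
Proof.
move=> minQ; apply/eqP => Q4.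
have gt1 : 1 < #|Q| by rewrite Q4.
have le2 v : v \in Q -> #|dominators Q v| <= 2.
  by move/(min_retentive_indegree minQ gt1); rewrite Q4.
have /fin_all_exists[f fP] (v : T) : exists s, v \in Q ->
    s \in dominators Q v /\ dominators (dominators B v) s = set0.
  case: (boolP (v \in Q)) => [vQ|_]; last by exists v.
  by have [s ? ?] := min_retentive_source minQ gt1 vQ (le2 v vQ); exists s.
have QB := subsetP (min_retentive_sub minQ).
have fQ v : v \in Q -> f v \in Q.
  by move=> /fP[]; rewrite in_dominators => /andP[].
have fdom v : v \in Q -> dominates (f v) v.
  by move=> /fP[]; rewrite in_dominators => /andP[].
have fcov v w : v \in Q -> w \in B -> dominates w v -> ~~ dominates w (f v).
  move=> vQ wB wv; have [_ /setP/(_ w)] := fP v vQ.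
  by rewrite !in_dominators wB wv inE /= => ->.
apply: (no_rotation4 Q4 fQ _ fdom); last by move=> v w vQ /QB wB; apply: fcov.
apply/imset_injP; have -> // : f @: Q = Q.
apply/eqP; rewrite eqEsubset; apply/andP; split.
  by apply/subsetP => x /imsetP[v vQ ->]; apply: fQ.
apply/subsetP => b bQ.
have [v [Q' [vQ minQ' bQ' sQ']]] := min_retentive_pred minQ gt1 bQ.
have sN := min_retentive_sub_dominators minQ' sQ'.
have [s eqQ'] := min_retentive_le2 minQ' (leq_trans (subset_leq_card sN) (le2 v vQ)).
have bs : b = s by apply/set1P; rewrite -eqQ'.
rewrite eqQ' -bs in minQ' sN.
have bv : dominates b v.
  by move: sN; rewrite sub1set in_dominators => /andP[].
(* Of two distinct undominated vertices [b] and [f v] of N^-(v), one would dominate the other. *)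
apply/imsetP; exists v => //; apply/eqP; apply: contraT => neq.
have := fcov v b vQ (QB _ bQ) bv; rewrite -dominatesN 1?eq_sym // => fb.
have /setP/(_ (f v)) := min_retentive1 minQ'.
by rewrite !in_dominators inE fb fdom // QB ?fQ.
Qed.

(** Only sizes 1 and 3 occur. For size 3, passing to undominated vertices [r] of N^-(p), [q] of
    N^-(r) and [s] of N^-(q) closes up with [s = p]. *)
Lemma min_retentive_le4 (T : tournament) (B Q : {set T}) (p : T) :
    min_retentive B Q -> #|Q| <= 4 -> p \in Q ->
  dominators B p = set0 \/
  exists q r, [/\ q \in Q, r \in Q,
    [/\ dominates p q, dominates q r & dominates r p] &
    [/\ dominators (dominators B p) r = set0,
        dominators (dominators B q) p = set0 &
        dominators (dominators B r) q = set0]].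
Proof.
move=> minQ le4 pQ; have [le2|gt2] := leqP #|Q| 2.
  have [s eqQ] := min_retentive_le2 minQ le2.
  have ps : p = s by apply/set1P; rewrite -eqQ.
  by left; apply: min_retentive1; rewrite ps -eqQ.
right; have gt1 : 1 < #|Q| by apply: ltnW.
have Q3 : #|Q| <= 3 by rewrite -ltnS ltn_neqAle (min_retentive_neq4 minQ).
have le2 v : v \in Q -> #|dominators Q v| <= 2.
  move/(min_retentive_indegree minQ gt1) => /leq_trans -> //.
  by case: #|Q| Q3 => [|[|[|[|]]]].
have [r] := min_retentive_source minQ gt1 pQ (le2 p pQ).
rewrite in_dominators => /andP[rQ rp] Npr.
have [q] := min_retentive_source minQ gt1 rQ (le2 r rQ).
rewrite in_dominators => /andP[qQ qr] Nrq.
have [s] := min_retentive_source minQ gt1 qQ (le2 q qQ).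
rewrite in_dominators => /andP[sQ sq] Nqs.
have qp : q != p by apply: contraTneq qr => ->; apply: dominates_asym.
have eqQ : Q =i [:: q; r; p].
  apply: uniq_subset_eq => //; last by apply/allP; rewrite /= qQ rQ pQ.
  by rewrite /= !inE negb_or qp !dominates_neq.
have sp : s = p.
  apply/eqP; move: sQ; rewrite eqQ !inE (negPf (dominates_neq sq)) /=.
  by case/orP => // /eqP sr; move: sq; rewrite sr (negPf (dominates_asym qr)).
by rewrite sp in sq Nqs; exists q, r.
Qed.

(** * Counting arcs and in-degrees *)

Lemma uniq_leq_card (T : finType) (A : {set T}) (s : seq T) :
  uniq s -> {subset s <= A} -> size s <= #|A|.
Proof.
by move=> us sA; rewrite cardE uniq_leq_size // => x /sA; rewrite mem_enum.
Qed.

Lemma card_dominatorsE (T : tournament) (B : {set T}) (v : T) :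
  #|dominators B v| = \sum_(u in B) dominates u v.
Proof.
rewrite -sum1_card big_mkcond [RHS]big_mkcond; apply: eq_bigr => u _.
by rewrite in_dominators; case: (u \in B); case: (dominates u v).
Qed.

Lemma sum_card_dominators (T : tournament) (A B : {set T}) :
  [disjoint A & B] ->
  \sum_(v in A) #|dominators B v| + \sum_(v in B) #|dominators A v| =
    #|A| * #|B|.
Proof.
move=> dis; under eq_bigr do rewrite card_dominatorsE.
under [X in _ + X]eq_bigr do rewrite card_dominatorsE.
rewrite [X in _ + X]exchange_big -big_split -sum_nat_const; apply: eq_bigr => v vA.
rewrite -big_split -sum1_card; apply: eq_bigr => u uB.
rewrite [dominates u v]dominatesN ?addn_negb //; last first.
  by apply: contraTneq uB => ->; rewrite (disjointFr dis).
by case: (dominates v u).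
Qed.

(** In-degrees and out-degrees have equal sums, together at most [#|R| * #|R|.-1]; in-degrees all at
    least half of [#|R|] would give [#|R| * #|R|]. *)
Lemma exists_small_indegree (T : tournament) (R : {set T}) : 0 < #|R| ->
  exists2 v, v \in R & #|dominators R v|.*2 < #|R|.
Proof.
move=> R0; apply/exists_inP; apply: contraT.
rewrite negb_exists_in => /forall_inP leN.
pose out v := \sum_(u in R) (dominates v u : nat).
have sumE : \sum_(v in R) #|dominators R v| = \sum_(v in R) out v.
  by under eq_bigr do rewrite card_dominatorsE; rewrite exchange_big.
have ge : #|R| * #|R| <= \sum_(v in R) #|dominators R v| + \sum_(v in R) out v.
  rewrite -sumE addnn -mul2n big_distrr /= -sum_nat_const.
  by apply: leq_sum => v /leN; rewrite -leqNgt mul2n.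
have le : \sum_(v in R) #|dominators R v| + \sum_(v in R) out v <= #|R| * #|R|.-1.
  rewrite -big_split -sum_nat_const; apply: leq_sum => v vR /=.
  rewrite card_dominatorsE -big_split /= (bigD1 v) //= dominates_irr.
  rewrite (cardsD1 v) vR /= -sum1_card.
  rewrite [X in _ <= X](eq_bigl (fun u => (u \in R) && (u != v))); last first.
    by move=> u; rewrite !inE andbC.
  apply: leq_sum => u /andP[_ uv].
  by rewrite (dominatesN uv); case: (dominates v u).
move: (leq_trans ge le); rewrite leq_pmul2l //.
by rewrite -[X in X <= _](prednK R0) ltnn.
Qed.

(** * Covered retentive sets with at most eight vertices *)

(** Without blocked pairs [Q] is no singleton. When [y] covers the side of [v], the vertices that
    [y] fails to dominate are dominators of [v] on the other side. *)
Lemma min_retentive_two_sided (T : tournament) (B R : {set T}) (v y : T) :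
    min_retentive B R -> v \in R -> y \in dominators B v ->
    {in R &, forall p q, dominators (dominators B p) q != set0} ->
  exists Q, [/\ min_retentive (dominators B v) Q, Q \subset dominators R v,
                1 < #|Q| & 1 < #|[set q in Q | ~~ dominates y q]|].
Proof.
move=> minR vR yv noP; have [Q minQ sQ] := min_retentive_step minR vR yv.
have gt1 : 1 < #|Q|.
  rewrite ltnNge; apply/negP => /leqW le2.
  have [q eqQ] := min_retentive_le2 minQ le2; rewrite eqQ in minQ sQ.
  by have := noP v q vR; rewrite -sub1set (min_retentive1 minQ) eqxx => /(_ sQ).
exists Q; split=> //; first exact: min_retentive_sub_dominators minQ sQ.
exact: min_retentive_undominated2 minQ gt1 yv.
Qed.

Lemma sum_nat_tight (I : finType) (A : {set I}) (F : I -> nat) (c : nat) :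
  {in A, forall i, c <= F i} -> \sum_(i in A) F i <= #|A| * c ->
  {in A, forall i, F i = c}.
Proof.
move=> geF leS i iA; apply/eqP; rewrite eqn_leq geF // andbT leqNgt.
apply/negP => gtF; move: leS; rewrite (bigD1 i) //= (cardsD1 i) iA mulnDl mul1n.
apply/negP; rewrite -ltnNge -addSn leq_add // -sum_nat_const.
rewrite (eq_bigl (fun j => (j \in A) && (j != i))); last first.
  by move=> j; rewrite !inE andbC.
by apply: leq_sum => j /andP[/geF].
Qed.

(** The inequality reads (a-2)(b-2) >= 4, while a-2 and b-2 sum to at most 4; the bound [0 < a + b]
    excludes a = b = 0. *)
Lemma two_sum_le_prod (a b : nat) :
  0 < a + b <= 8 -> 2 * (a + b) <= a * b -> a = 4 /\ b = 4.
Proof. by do 9?[case: a => [|a]]; do 9?[case: b => [|b]]; lia. Qed.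

Lemma covered_pair (T : tournament) (B R : {set T}) (y1 y2 : T) :
    min_retentive B R -> #|R| <= 8 -> y1 \in B -> y2 \in B ->
    {in R, forall v, dominates y1 v || dominates y2 v} ->
  exists p q, [/\ p \in R, q \in R & dominators (dominators B p) q = set0].
Proof.
move=> minR le8 y1B y2B cov.
case: (boolP [exists p in R, exists q in R,
                dominators (dominators B p) q == set0]) => [|no].
  by case/exists_inP => p pR /exists_inP[q qR /eqP]; exists p, q.
exfalso; have {no}noP : {in R &, forall p q, dominators (dominators B p) q != set0}.
  move=> p q pR qR; apply: contra no => pq.
  by apply/exists_inP; exists p => //; apply/exists_inP; exists q.
pose A1 := [set v in R | dominates y1 v]; pose A2 := R :\: A1.
have A1R v : v \in A1 -> v \in R by rewrite inE => /andP[].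
have A2R v : v \in A2 -> v \in R by rewrite !inE => /andP[].
have y1A v : v \in A1 -> y1 \in dominators B v.
  by rewrite in_dominators y1B inE => /andP[].
have y2A v : v \in A2 -> y2 \in dominators B v.
  rewrite in_dominators y2B !inE => /andP[+ vR]; rewrite vR /=.
  by have := cov v vR; case: (dominates y1 v).
have dis : [disjoint A1 & A2] by rewrite disjoint_sym disjoints_subset subsetDr.
have cardR : #|A1| + #|A2| = #|R|.
  rewrite -[RHS](cardsID A1) (setIidPr _) //.
  by apply/subsetP => v /A1R.
have sub2 (Q : {set T}) v : Q \subset dominators R v ->
    [set q in Q | ~~ dominates y1 q] \subset dominators A2 v.
  move=> sQ; apply/subsetP => q; rewrite inE => /andP[/(subsetP sQ)].
  by rewrite !in_dominators => /andP[qR ->] yq; rewrite !inE qR (negPf yq).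
have opp1 v : v \in A1 -> 2 <= #|dominators A2 v|.
  move=> vA; have [Q [_ sQ _ /leq_trans->//]] :=
    min_retentive_two_sided minR (A1R _ vA) (y1A _ vA) noP.
  exact/subset_leq_card/sub2.
have opp2 v : v \in A2 -> 2 <= #|dominators A1 v|.
  move=> vA; have [Q [_ sQ _ /leq_trans->//]] :=
    min_retentive_two_sided minR (A2R _ vA) (y2A _ vA) noP.
  apply/subset_leq_card/subsetP => q; rewrite inE => /andP[/(subsetP sQ)].
  rewrite !in_dominators => /andP[qR ->] yq; rewrite inE qR !andbT /=.
  by have := cov q qR; rewrite (negPf yq) orbF.
have sumA := sum_card_dominators dis.
have [A14 A24] : #|A1| = 4 /\ #|A2| = 4.
  have [v0 v0R] := min_retentive_neq0 minR.
  apply: two_sum_le_prod.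
    by rewrite cardR le8 andbT card_gt0; apply/set0Pn; exists v0.
  rewrite mulnC mulnDl -sumA -!sum_nat_const.
  by apply: leq_add; apply: leq_sum.
have ge1 : #|A1| * 2 <= \sum_(v in A1) #|dominators A2 v|.
  by rewrite -sum_nat_const; apply: leq_sum.
have ge2 : #|A2| * 2 <= \sum_(v in A2) #|dominators A1 v|.
  by rewrite -sum_nat_const; apply: leq_sum.
have tight1 : {in A1, forall v, #|dominators A2 v| = 2}.
  by apply: sum_nat_tight => //; lia.
have tight2 : {in A2, forall v, #|dominators A1 v| = 2}.
  by apply: sum_nat_tight => //; lia.
(* Of the two dominators of v in A2, the one that dominates the other is itself
   dominated by some a in A1; only the other one remains to form a retentive set
   of N^-(v, a). So ab is the pair of this a and that other dominator. *)
have /fin_all_exists[g gP] (v : T) : exists ab : T * T, v \in A1 ->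
    [/\ ab.1 \in A1, dominates ab.1 v, ab.2 \in A2, dominates ab.2 v &
        dominates ab.2 ab.1 /\
        dominators (dominators (dominators B v) ab.1) ab.2 = set0].
  case: (boolP (v \in A1)) => [vA|_]; last by exists (v, v).
  have [Q [minQ sQ gt1 gt2]] := min_retentive_two_sided minR (A1R _ vA) (y1A _ vA) noP.
  have [b1 [b2 [b12 eqD]]] : exists b1 b2, dominates b1 b2 /\
      [set q in Q | ~~ dominates y1 q] = [set b1; b2].
    have /cards2P[p [q [pq eqD]]] : #|[set q in Q | ~~ dominates y1 q]| == 2.
      by rewrite eqn_leq gt2 -(tight1 v vA) subset_leq_card // sub2.
    have /orP[|] := dominates_complete pq; first by exists p, q.
    by exists q, p; rewrite setUC.
  have inD q : q \in Q -> dominates y1 q = false -> q \in [set b1; b2].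
    by move=> qQ yq; rewrite -eqD inE qQ yq.
  have : b1 \in [set b1; b2] by rewrite set21.
  have : b2 \in [set b1; b2] by rewrite set22.
  rewrite -eqD !inE => /andP[b2Q yb2] /andP[b1Q yb1].
  have := subsetP (sub2 Q v sQ) b2; rewrite inE b2Q yb2 => /(_ isT).
  rewrite in_dominators => /andP[b2A b2v].
  have [a aQ ab1] := min_retentive_dominator minQ gt1 b1Q.
  have ya : dominates y1 a.
    apply: contraT => /negbTE /(inD a aQ) /set2P[] eqa; move: ab1; rewrite eqa.
      by rewrite dominates_irr.
    by rewrite (negPf (dominates_asym b12)).
  have := subsetP sQ a aQ; rewrite in_dominators => /andP[aR av].
  have yNa : y1 \in dominators (dominators B v) a by rewrite in_dominators y1A.
  have [Q' minQ' sQ'] := min_retentive_step minQ aQ yNa.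
  have sD : [set q in Q' | ~~ dominates y1 q] \subset [set b2].
    apply/subsetP => q; rewrite inE => /andP[qQ' /negbTE yq].
    have := inD q (subsetP sQ' q qQ') yq; rewrite !inE => /orP[/eqP eqq|//].
    have := subsetP (min_retentive_sub minQ') q qQ'; rewrite in_dominators eqq.
    by rewrite (negPf (dominates_asym ab1)) andbF.
  have le1 := subset_leq_card sD; rewrite cards1 in le1.
  have [q eqQ'] : exists q, Q' = [set q].
    apply: (min_retentive_le2 minQ'); apply: ltnW; rewrite ltnS leqNgt.
    apply/negP => /(min_retentive_undominated2 minQ') /(_ yNa).
    by rewrite ltnNge le1.
  have [q' q'Q' yq'] := min_retentive_undominated minQ' yNa.
  have q'b : q' = b2 by apply/set1P/(subsetP sD); rewrite inE q'Q'.
  have qb : q = b2 by apply/eqP; rewrite -q'b eq_sym -in_set1 -eqQ'.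
  rewrite qb in eqQ'; rewrite eqQ' in minQ'; exists (a, b2) => _ /=.
  split=> //; first by rewrite inE aR.
  split; last exact: min_retentive1.
  have := subsetP (min_retentive_sub minQ') b2 (set11 _).
  by rewrite in_dominators => /andP[].
(* By tightness exactly two of the four vertices of [A1] dominate [b], which leaves two for [b] to
   dominate. *)
have out2 b s : b \in A2 -> uniq s -> {subset s <= A1} ->
    {in s, forall v, dominates b v} -> size s <= 2.
  move=> bA us sA sb.
  have -> : 2 = #|A1 :\: dominators A1 b|.
    rewrite cardsD (setIidPr _) ?tight2 ?A14 //.
    by apply/subsetP => x; rewrite in_dominators => /andP[].
  apply: uniq_leq_card => // x xs; rewrite !inE (negPf (dominates_asym (sb x xs))).
  by rewrite andbF; have := sA x xs; rewrite inE.
pose f v := (g v).1; pose beta v := (g v).2.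
have {}gP v : v \in A1 -> [/\ f v \in A1, dominates (f v) v, beta v \in A2,
    dominates (beta v) v & dominates (beta v) (f v) /\
    dominators (dominators (dominators B v) (f v)) (beta v) = set0] by apply: gP.
(* By [gP], a common dominator [w] of [v] and [f v] does not dominate [beta v]; then [beta v]
   dominates [w], [f v] and [v], against [out2]. *)
have fcov : {in A1 &, forall v w, dominates w v -> ~~ dominates w (f v)}.
  move=> v w vA wA wv; apply/negP => wf.
  have [fA fv bA bv [bf N0]] := gP v vA.
  have wb : dominates w (beta v).
    rewrite dominatesN; last by apply: contraTneq bA => <-; rewrite (disjointFr dis).
    apply/negP => bw; have: 3 <= 2; last by [].
    apply: (@out2 (beta v) [:: w; f v; v]) => //.
    - by rewrite /= !inE negb_or !dominates_neq.
    - by apply/allP; rewrite /= wA fA vA.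
    - by apply/allP; rewrite /= bw bf bv.
  have /setP/(_ w) := N0.
  by rewrite !in_dominators wv wf wb !andbT inE (subsetP (min_retentive_sub minR)) ?A1R.
(* A common value dominates [v], [w], [f v] and [f w]; by [out2] this forces [f v = w] and
   [f w = v], against asymmetry. *)
have betaI : {in A1 &, injective beta}.
  move=> v w vA wA eqb; apply/eqP; apply: contraT => neq.
  have [fvA fv bA bv [bf _]] := gP v vA; have [fwA fw _ bw [bfw _]] := gP w wA.
  rewrite -eqb in bw bfw.
  have eqf x : x \in A1 -> dominates (beta v) x -> x \in [:: v; w].
    move=> xA bx; apply: contraT => xs.
    have: 3 <= 2; last by [].
    apply: (@out2 (beta v) [:: x; v; w]) => //.
    - by rewrite cons_uniq xs /= inE neq.
    - by apply/allP; rewrite /= xA vA wA.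
    - by apply/allP; rewrite /= bx bv bw.
  have := eqf _ fvA bf; rewrite !inE (negPf (dominates_neq fv)) /= => /eqP fvw.
  have := eqf _ fwA bfw; rewrite !inE (negPf (dominates_neq fw)) orbF => /eqP fwv.
  by move: fv fw; rewrite fvw fwv => /dominates_asym/negPf->.
apply: (@no_rotation4 _ A1 f A14 _ _ _ fcov).
- by move=> v /gP[].
- move=> v w vA wA eqf; apply/eqP; apply: contraT => neq.
  have [fvA fv bA bv [bf _]] := gP v vA; have [fwA fw bwA bw [bfw _]] := gP w wA.
  have [_ _ baA ba _] := gP (f v) fvA.
  (* If [f v = f w], the values of [beta] at [v], [w] and [f v] are three dominators of this vertex;
     tightness allows two. *)
  have: 3 <= #|dominators A2 (f v)|; last by rewrite tight1.
  apply: (@uniq_leq_card _ _ [:: beta v; beta w; beta (f v)]).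
    rewrite /= !inE !negb_or !(inj_in_eq betaI) // neq.
    by rewrite eq_sym (dominates_neq fv) eqf eq_sym (dominates_neq fw).
  move=> x; rewrite !inE => /or3P[] /eqP->; rewrite ?bf ?ba.
  - by move: bA; rewrite !inE => ->.
  - by move: bwA; rewrite eqf bfw !inE => ->.
  - by move: baA; rewrite !inE => ->.
- by move=> v /gP[].
Qed.

(** * The six-vertex case as a finite check *)

(* Vertices are numbered; d relates vertices of different colours. blocked2
   and blocked3 state that the given vertices have no common dominator and are
   not all of one colour. By link, p lies in a retentive set of N^-(u) that is
   {p} or a 3-cycle p > q > r > p. *)
Definition preds (V : seq nat) (e : rel nat) (u : nat) : seq nat :=
  [seq z <- V | e z u].

Definition blocked2 (V : seq nat) (e d : rel nat) (u p : nat) : bool :=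
  d u p && ~~ has (e^~ p) (preds V e u).

Definition blocked3 (V : seq nat) (e d : rel nat) (u p q : nat) : bool :=
  (d u p || d u q) && ~~ has (fun z => e z p && e z q) (preds V e u).

Definition link (V : seq nat) (e d : rel nat) (u p : nat) : bool :=
  e p u && (blocked2 V e d u p ||
    has (fun q => e p q && has (fun r => [&& e q r, e r p, blocked3 V e d u p q,
        blocked3 V e d u q r & blocked3 V e d u r p])
      (preds V e u)) (preds V e u)).

Definition linked (V : seq nat) (e d : rel nat) : bool :=
  all (fun p => has (fun u => link V e d u p) V) V &&
  all (fun u => has (link V e d u) V) V.

(** [D] abstracts the colour condition: it is taken constantly true for the uncoloured test and as
    inequality of colours for the coloured one. In-degrees in [R] are at most 4, so
    [min_retentive_le4] describes the retentive sets involved. *)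
Lemma min_retentive_linked (T : tournament) (B R : {set T}) (D : rel T)
    (r : nat -> T) (e d : rel nat) :
    min_retentive B R -> #|R| = 6 ->
    (forall u p, u \in R -> p \in R ->
       dominators (dominators B u) p = set0 -> D u p) ->
    (forall u p q, u \in R -> p \in R -> q \in R ->
       dominators (dominators (dominators B u) q) p = set0 ->
       D u p || D u q) ->
    (forall i, i < 6 -> r i \in R) ->
    (forall u, u \in R -> exists2 i, i < 6 & u = r i) ->
    (forall i j, i < 6 -> j < 6 -> e i j = dominates (r i) (r j)) ->
    (forall i j, i < 6 -> j < 6 -> d i j = D (r i) (r j)) ->
  linked (iota 0 6) e d.
Proof.
move=> minR R6 D2 D3 rR rP eE dE; set V := iota 0 6.
have V6 i : (i \in V) = (i < 6) by rewrite mem_iota.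
have gt1 : 1 < #|R| by rewrite R6.
have predsE u z : u < 6 ->
    (z \in preds V e u) = (z < 6) && dominates (r z) (r u).
  by move=> u6; rewrite mem_filter V6 andbC; case: (ltnP z 6) => // z6; rewrite eE.
have blocked3P u p q : u < 6 -> p < 6 -> q < 6 ->
    dominators (dominators (dominators B (r u)) (r q)) (r p) = set0 -> blocked3 V e d u p q.
  move=> u6 p6 q6 N0; rewrite /blocked3 !dE // (D3 _ _ _ _ _ _ N0) ?rR //=.
  apply/hasPn => z; rewrite predsE // => /andP[z6 zu]; apply/negP; rewrite !eE //.
  case/andP => zp zq; have /setP/(_ (r z)) := N0.
  by rewrite !in_dominators zu zp zq !andbT inE (subsetP (min_retentive_sub minR)) ?rR.
have linkP u p Q : u < 6 -> p < 6 -> min_retentive (dominators B (r u)) Q ->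
    Q \subset dominators R (r u) -> r p \in Q -> link V e d u p.
  move=> u6 p6 minQ sQ pQ; have Q4 : #|Q| <= 4.
    rewrite (leq_trans (subset_leq_card sQ)) //.
    by have := min_retentive_indegree minR gt1 (rR u u6); rewrite R6.
  have QN q : q \in Q -> exists2 i, i \in preds V e u & q = r i.
    move=> /(subsetP sQ); rewrite in_dominators => /andP[/rP[i i6 ->] iu].
    by exists i => //; rewrite predsE // i6.
  have [i] := QN _ pQ; rewrite predsE // => /andP[i6 iu] eqp.
  rewrite /link eE // eqp iu /=.
  have [N0|[q [s [qQ sQ' [pq qs sp] [Nps Nqp Nsq]]]]] := min_retentive_le4 minQ Q4 pQ.
    apply/orP; left; rewrite /blocked2 dE // (D2 _ _ _ _ N0) ?rR //=.
    apply/hasPn => z; rewrite predsE // => /andP[z6 zu]; apply/negP; rewrite eE //.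
    move=> zp; have /setP/(_ (r z)) := N0.
    by rewrite !in_dominators zu zp !andbT inE (subsetP (min_retentive_sub minR)) ?rR.
  have [j jN eqq] := QN _ qQ; have [k kN eqs] := QN _ sQ'.
  move: (jN) (kN); rewrite !predsE // => /andP[j6 ju] /andP[k6 ku].
  subst q s; apply/orP; right; apply/hasP; exists j => //; rewrite eE // pq /=.
  apply/hasP; exists k => //.
  by rewrite !eE // qs sp !blocked3P.
apply/andP; split; apply/allP.
  move=> p; rewrite V6 => p6.
  have [v [Q [vR minQ pQ sQ]]] := min_retentive_pred minR gt1 (rR p p6).
  have [u u6 eqv] := rP v vR; rewrite eqv in minQ.
  apply/hasP; exists u; rewrite ?V6 //.
  by apply: (linkP u p Q) => //; apply: min_retentive_sub_dominators minQ sQ.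
move=> u; rewrite V6 => u6.
have [w wR wu] := min_retentive_dominator minR gt1 (rR u u6).
have wN : w \in dominators B (r u).
  by rewrite in_dominators wu (subsetP (min_retentive_sub minR)).
have [Q minQ sQ] := min_retentive_step minR (rR u u6) wN.
have [q qQ] := min_retentive_neq0 minQ; have [p p6 eqq] := rP q (subsetP sQ q qQ).
rewrite eqq in qQ; apply/hasP; exists p; rewrite ?V6 //.
by apply: (linkP u p Q) => //; apply: min_retentive_sub_dominators minQ sQ.
Qed.

Fixpoint all_bits (n : nat) (P : pred (seq bool)) : bool :=
  if n is m.+1 then
    all_bits m (fun s => P (true :: s)) && all_bits m (fun s => P (false :: s))
  else P [::].

Lemma all_bitsP (n : nat) (P : pred (seq bool)) (s : seq bool) :
  all_bits n P -> size s = n -> P s.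
Proof.
elim: n P s => [|n IHn] P [|b s] //= /andP[Pt Pf] [sn].
by case: b; [apply: (IHn (fun s => P (true :: s)))
            |apply: (IHn (fun s => P (false :: s)))].
Qed.

(* s lists the arcs (0,1), (0,2), (1,2), (0,3), ..; a missing arc (i,j) means
   that j dominates i. *)
Definition arc (s : seq bool) (i j : nat) : bool :=
  if i < j then nth false s ('C(j, 2) + i)
  else (j < i) && ~~ nth false s ('C(i, 2) + j).

(* Tabulating the arcs only saves time. *)
Definition arc_table (s : seq bool) : rel nat :=
  let M := [seq [seq arc s i j | j <- iota 0 6] | i <- iota 0 6] in
  fun i j => nth false (nth [::] M i) j.

Lemma arc_tableE (s : seq bool) (i j : nat) :
  i < 6 -> j < 6 -> arc_table s i j = arc s i j.
Proof. by move=> i6 j6; rewrite /arc_table !(nth_map 0) ?size_iota ?nth_iota. Qed.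

(* Twelve bits leave out the arcs (2,5), (3,5), (4,5): vertex 5 has in-degree
   at most 2. *)
Lemma no_two_coloring6 :
  all_bits 12 (fun s =>
    linked (iota 0 6) (arc_table s) (fun _ _ => true) ==>
    all_bits 6 (fun c => ~~ linked (iota 0 6) (arc_table s)
                             (fun i j => nth false c i != nth false c j))).
Proof. exact: isT. Qed.

(** A vertex is coloured by whether [y1] dominates it. Vertices of one colour have [y1] or [y2] as a
    common dominator, so blocked pairs and triples meet both colours. *)
Lemma not_covered6 (T : tournament) (B R : {set T}) (y1 y2 : T) :
    min_retentive B R -> #|R| = 6 -> y1 \in B -> y2 \in B ->
  ~ {in R, forall v, dominates y1 v || dominates y2 v}.
Proof.
move=> minR R6 y1B y2B cov.
have [x xR] : exists2 v, v \in R & #|dominators R v|.*2 < #|R|.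
  by apply: exists_small_indegree; rewrite R6.
rewrite R6 => le2; have {}le2 : #|dominators R x| <= 2 by lia.
(* The dominators of [x] come first and [x] last, so only vertices 0 and 1 can dominate vertex 5. *)
pose rs := enum (dominators R x) ++ enum (R :\ x :\: dominators R x) ++ [:: x].
pose r := nth x rs.
have rsE : rs =i R.
  move=> v; rewrite !mem_cat !mem_enum !inE.
  have [->|] := eqVneq v x; first by rewrite xR !orbT.
  by case: (v \in R); case: (dominates v x).
have rsU : uniq rs.
  rewrite !cat_uniq !enum_uniq /= orbF mem_enum !inE eqxx !andbF.
  rewrite has_cat /= mem_enum in_dominators dominates_irr andbF.
  by rewrite !orbF !andbT; apply/hasPn => v; rewrite /= !mem_enum => /setDP[].
have rs6 : size rs = 6 by rewrite -(card_uniqP rsU) (eq_card rsE).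
have rR i : i < 6 -> r i \in R by move=> i6; rewrite -rsE mem_nth ?rs6.
have rP u : u \in R -> exists2 i, i < 6 & u = r i.
  by rewrite -rsE => /(nthP x)[i]; rewrite rs6 => i6 <-; exists i.
have r5 : r 5 = x by rewrite /r -[5]/(6.-1) -rs6 nth_last !last_cat.
have r25 i : 1 < i < 6 -> dominates (r i) (r 5) = false.
  case/andP => i1 i6; apply: contraTF i1; rewrite r5 -leqNgt => ix.
  have iN : r i \in enum (dominators R x) by rewrite mem_enum in_dominators rR.
  have := index_uniq x (i := i) (s := rs); rewrite rs6 => /(_ i6 rsU) <-.
  rewrite -/(r i) index_cat iN -ltnS; apply: leq_trans le2.
  by rewrite cardE index_mem.
pose s := [seq dominates (r p.1) (r p.2) |
  p <- [:: (0, 1); (0, 2); (1, 2); (0, 3); (1, 3); (2, 3);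
           (0, 4); (1, 4); (2, 4); (3, 4); (0, 5); (1, 5)]].
have sE i j : i < j < 6 -> nth false s ('C(j, 2) + i) = dominates (r i) (r j).
  (* For [j = 5] and [i >= 2] the index runs past the twelve bits; the default [false] is right by
     [r25]. *)
  case/andP; case: j => [|[|[|[|[|[|j]]]]]] //; case: i => [|[|[|[|[|i]]]]] // _ _;
    by rewrite r25.
have arcE i j : i < 6 -> j < 6 -> arc_table s i j = dominates (r i) (r j).
  move=> i6 j6; rewrite arc_tableE // /arc.
  case: (ltngtP i j) => [ij|ji|->]; last by rewrite dominates_irr.
    by rewrite sE // ij.
  rewrite sE ?ji // -dominatesN // nth_uniq ?rs6 //.
  by rewrite gtn_eqF.
pose c := [seq dominates y1 (r i) | i <- iota 0 6].
have cE i : i < 6 -> nth false c i = dominates y1 (r i).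
  by move=> i6; rewrite (nth_map 0) ?size_iota ?nth_iota.
have cov2 v : v \in R -> dominates y1 v = false -> dominates y2 v.
  by move=> vR yv; have := cov v vR; rewrite yv.
have linkT : linked (iota 0 6) (arc_table s) (fun _ _ => true).
  exact: (min_retentive_linked minR R6 (D := fun _ _ => true) _ _ rR rP arcE).
have /implyP/(_ linkT) colP := all_bitsP no_two_coloring6 (s := s) erefl.
apply: (negP (all_bitsP colP (s := c) erefl)).
apply: (min_retentive_linked minR R6
  (D := fun u v => dominates y1 u != dominates y1 v) _ _ rR rP arcE).
- move=> u p uR pR N0; apply/negP => /eqP eqp.
  have [y [yB yu yp]] : exists y, [/\ y \in B, dominates y u & dominates y p].
    case yu: (dominates y1 u); first by exists y1; rewrite -eqp.
    by exists y2; rewrite !cov2 // -eqp.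
  by have /setP/(_ y) := N0; rewrite !in_dominators yB yu yp inE.
- move=> u p q uR pR qR N0; rewrite -negb_and; apply/negP => /andP[/eqP eqp /eqP eqq].
  have [y [yB yu yp yq]] : exists y,
      [/\ y \in B, dominates y u, dominates y p & dominates y q].
    case yu: (dominates y1 u); first by exists y1; rewrite -eqp -eqq.
    by exists y2; rewrite !cov2 // -?eqp -?eqq.
  by have /setP/(_ y) := N0; rewrite !in_dominators yB yu yp yq inE.
- by move=> i j i6 j6; rewrite !cE.
Qed.

Theorem theorem6 :
  ~ exists (T : tournament) (R1 R2 : {set T}),
      [/\ R1 <> R2,
          min_retentive [set: T] R1,
          min_retentive [set: T] R2,
          #|R1| = 6 &
          #|R2| \in [:: 6; 7; 8]].
Proof.
case=> T [R1 [R2 [neq min1 min2 R16 R2le]]].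
have dis := min_retentive_disjoint min1 min2 neq.
(* By disjointness [v] differs from [p] and [q], so failing to dominate one of them means being
   dominated by it. *)
have covers (A B : {set T}) p q : [disjoint A & B] -> p \in A -> q \in A ->
    dominators (dominators [set: T] p) q = set0 ->
    {in B, forall v, dominates p v || dominates q v}.
  move=> disAB pA qA /setP N0 v vB; have := N0 v.
  have neqA u : u \in A -> v != u by apply: contraTneq => <-; rewrite (disjointFl disAB).
  rewrite !in_dominators !inE (dominatesN (neqA p pA)) (dominatesN (neqA q qA)).
  by move/negbT; rewrite negb_and !negbK.
have [v vR1] : exists2 v, v \in R1 & #|dominators R1 v|.*2 < #|R1|.
  by apply: exists_small_indegree; rewrite R16.
rewrite R16 => le2; have {}le2 : #|dominators R1 v| <= 2 by lia.
have gt1 : 1 < #|R1| by rewrite R16.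
have [s sR1 N0] := min_retentive_source min1 gt1 vR1 le2.
have {}sR1 : s \in R1 by move: sR1; rewrite in_dominators => /andP[].
have le8 : #|R2| <= 8 by move: R2le; rewrite !inE => /or3P[] /eqP->.
have [p [q [pR2 qR2 Npq]]] := covered_pair min2 le8 (in_setT v) (in_setT s)
  (covers _ _ _ _ dis vR1 sR1 N0).
apply: (not_covered6 min1 R16 (in_setT p) (in_setT q)).
by apply: covers pR2 qR2 Npq; rewrite disjoint_sym.
Qed.
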